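(* Let $\mathrm{SL}_n(\mathbf{C})$ act on its Lie algebra $\mathfrak{sl}_n(\mathbf{C})$ by conjugation. For every $n \geq 2$ we have $\mathsf{C}(\mathfrak{sl}_n(\mathbf{C})) < 18$.
   Context: For a group $H$ acting linearly on a finite-dimensional complex vector space $V$ and a nonzero subspace $U \leq V$, the group-additive diameter is $$\mathrm{diam}_+^{H}(V,U) = \min\{ m \mid g_1\cdot U + \dots + g_m\cdot U = V \text{ for some } g_1,\dots,g_m \in H\}.$$ If $H$ acts irreducibly on $V$, put $\mathsf{R}(V,U) = \mathrm{diam}_+^{H}(V,U) / \lceil \dim V/\dim U\rceil$, and the covering complexity of $V$ (with respect to $H$) is $\mathsf{C}(V) = \max_{0 \neq U \leq V} \mathsf{R}(V,U)$. In the claim $H = \mathrm{SL}_n(\mathbf{C})$. *)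

(* Defs.v *)
From HB Require Import structures.
From mathcomp Require Import all_boot all_order all_algebra.
From mathcomp Require Import complex reals.

Set Implicit Arguments.
Unset Strict Implicit.
Unset Printing Implicit Defensive.

Import Order.TTheory GRing.Theory Num.Theory.
Local Open Scope ring_scope.

Record linear_rep (K : fieldType) (H : groupType) (V : vectType K) :=
  LinearRep {
    rep_fun :> H -> 'End(V);
    rep1 : rep_fun 1%g = \1%VF;
    repM : forall g h : H, rep_fun (g * h)%g = (rep_fun g \o rep_fun h)%VF
  }.

Section CoveringComplexity.

Variables (K : fieldType) (H : groupType) (V : vectType K).
Variable rho : linear_rep H V.

Definition irreducible_rep : Prop :=
  (fullv : {vspace V}) <> 0%VS /\
  forall W : {vspace V},
    (forall g : H, (rho g @: W <= W)%VS) -> W = 0%VS \/ W = fullv.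

Definition translates_cover (U : {vspace V}) (m : nat) : Prop :=
  exists g : 'I_m -> H, (\sum_(i < m) (rho (g i) @: U))%VS = fullv.

(* Minima and maxima are given by their graphs, so that "the diameter is m"
   or "the covering complexity is c" also asserts that the extremum exists. *)
Definition is_group_diam (U : {vspace V}) (m : nat) : Prop :=
  translates_cover U m /\ forall k, translates_cover U k -> (m <= k)%N.

Definition is_covering_ratio (U : {vspace V}) (r : rat) : Prop :=
  exists2 m : nat, is_group_diam U m &
    r = m%:R / (Num.ceil ((\dim {:V})%:R / (\dim U)%:R : rat))%:~R.

Definition is_covering_complexity (c : rat) : Prop :=
  [/\ irreducible_rep,
      exists2 U : {vspace V}, U <> 0%VS & is_covering_ratio U c
    & forall U : {vspace V}, U <> 0%VS ->
        exists2 r : rat, is_covering_ratio U r & r <= c].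

End CoveringComplexity.

Section SpecialLinear.

Variables (F : fieldType) (n : nat).

Record SL := MkSL { SLval :> 'M[F]_n; _ : \det SLval == 1 }.

HB.instance Definition _ := [isSub for SLval].
HB.instance Definition _ := [Choice of SL by <:].

Lemma SL_det (g : SL) : \det g = 1.
Proof. by case: g => g /= /eqP. Qed.

Lemma SL_unit (g : SL) : (g : 'M[F]_n) \in unitmx.
Proof. by rewrite unitmxE SL_det unitr1. Qed.

Fact SL_one_subproof : \det (1%:M : 'M[F]_n) == 1.
Proof. by rewrite det1. Qed.
Fact SL_mul_subproof (g h : SL) : \det ((g : 'M[F]_n) *m h) == 1.
Proof. by rewrite det_mulmx !SL_det mulr1. Qed.
Fact SL_inv_subproof (g : SL) : \det (invmx (g : 'M[F]_n)) == 1.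
Proof. by rewrite det_inv SL_det invr1. Qed.

Definition SL_one : SL := MkSL SL_one_subproof.
Definition SL_mul (g h : SL) : SL := MkSL (SL_mul_subproof g h).
Definition SL_inv (g : SL) : SL := MkSL (SL_inv_subproof g).

Fact SL_mulA : associative SL_mul.
Proof. by move=> x y z; apply: val_inj; rewrite /= mulmxA. Qed.
Fact SL_mul1 : left_id SL_one SL_mul.
Proof. by move=> x; apply: val_inj; rewrite /= mul1mx. Qed.
Fact SL_mulr1 : right_id SL_one SL_mul.
Proof. by move=> x; apply: val_inj; rewrite /= mulmx1. Qed.
Fact SL_mulV : left_inverse SL_one SL_inv SL_mul.
Proof. by move=> x; apply: val_inj; rewrite /= mulVmx ?SL_unit. Qed.
Fact SL_mulVr : right_inverse SL_one SL_inv SL_mul.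
Proof. by move=> x; apply: val_inj; rewrite /= mulmxV ?SL_unit. Qed.

HB.instance Definition _ :=
  isGroup.Build SL SL_mulA SL_mul1 SL_mulr1 SL_mulV SL_mulVr.

Definition slspace : {vspace 'M[F]_n} :=
  lker (linfun (mxtrace : 'M[F]_n -> F^o)).

Lemma mem_slspace (A : 'M[F]_n) : (A \in slspace) = (\tr A == 0).
Proof. by rewrite memv_ker lfunE. Qed.

Definition sl : vectType F := subvs_of slspace.

Definition conj_fun (g : SL) (A : 'M[F]_n) : 'M[F]_n :=
  (g : 'M[F]_n) *m A *m invmx g.

Fact conj_subproof (g : SL) (A : sl) : conj_fun g (vsval A) \in slspace.
Proof.
rewrite mem_slspace /conj_fun mxtrace_mulC mulmxA mulVmx ?SL_unit // mul1mx.
by rewrite -mem_slspace subvsP.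
Qed.

Definition conj_sl (g : SL) (A : sl) : sl := Subvs (conj_subproof g A).

Fact conj_sl_linear (g : SL) : linear (conj_sl g).
Proof.
move=> a A B; apply: val_inj => /=.
by rewrite /conj_fun mulmxDr mulmxDl -scalemxAr -scalemxAl.
Qed.

HB.instance Definition _ (g : SL) :=
  GRing.isLinear.Build F sl sl *:%R (conj_sl g) (conj_sl_linear g).

Lemma val_conj_sl (g : SL) (A : sl) :
  vsval (conj_sl g A) = (g : 'M[F]_n) *m vsval A *m invmx g.
Proof. by []. Qed.

Definition conj_lfun (g : SL) : 'End(sl) := linfun (conj_sl g).

Fact conj_lfun1 : conj_lfun 1%g = \1%VF.
Proof.
apply/lfunP => A; rewrite lfunE id_lfunE; apply: val_inj => /=.
by rewrite /conj_fun /= invmx1 mul1mx mulmx1.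
Qed.

Fact conj_lfunM (g h : SL) :
  conj_lfun (g * h)%g = (conj_lfun g \o conj_lfun h)%VF.
Proof.
apply/lfunP => A; rewrite comp_lfunE !lfunE; apply: val_inj => /=.
rewrite /conj_fun /=.
suff ->: invmx ((g : 'M[F]_n) *m h) = invmx h *m invmx g by rewrite !mulmxA.
have gh : (g : 'M[F]_n) *m h \in unitmx by rewrite unitmx_mul !SL_unit.
rewrite -[RHS](mulmxK gh) -[_ *m (_ *m (_ : 'M_n))]mulmxA.
by rewrite (mulmxA (invmx g)) mulVmx ?SL_unit // mul1mx mulVmx ?SL_unit // mul1mx.
Qed.

Definition conj_rep : linear_rep SL sl := LinearRep conj_lfun1 conj_lfunM.

End SpecialLinear.

(* Main.v *)
Require Import Defs.
From HB Require Import structures.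
From mathcomp Require Import all_boot all_order all_fingroup all_algebra.
From mathcomp Require Import complex reals boolp zify.

(** Why the bound holds.  Write n = a + b with a = floor (n / 2), let
    N = n ^ 2 - 1 be the dimension of sl_n, d = dim U and X = ceil (N / d).
    The proof covers sl_n by 12 X conjugates of U, so the covering complexity
    is at most 12.

    Let p be the projection of a matrix onto its upper right a x b block.  For
    a general g, the image p (g U g^-1) has its fair share of the dimension:
    its dimension q satisfies q / (a b) >= d / N.  This is [large_corner], an
    instance of a slope argument, [rank_slope]: the generic rank on subspaces
    is submodular, so the largest subspace that minimises
    N (generic rank) - a b (dimension) is stable under the group, hence 0 or
    everything by irreducibility, and the minimum is 0.

    Rescaling by a one-parameter torus degenerates g U g^-1 to a space that
    contains, for each row i of the block, all matrices supported on row i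
    with entries in a space Q_i of row vectors, where the dimensions of the
    Q_i add up to q ([sum_leading_row], [rescaled0]).  Covering is an open
    condition, so it is enough to cover with this limit
    ([dim_sum_semicontinuous]).  Conjugating by block diagonal matrices permutes
    the Q_i and moves them by a general element of GL_b.  Choosing the
    permutations greedily gives every row the same total dimension up to an
    error b, and general elements of GL_b put the spaces in general position;
    hence 2 X conjugates cover the whole block Hom(C^b, C^a), since
    2 X q >= 2 a b ([row_spaces_cover]).

    Finally six conjugates of this block span sl_n ([six_graphs_perp]): a
    matrix orthogonal to all of them for the trace form preserves six
    subspaces, the graphs of six maps from C^a to C^b, chosen so that only
    scalar matrices preserve them all.  Altogether 6 (2 X) conjugates suffice
    ([corner_cover]).

    The maximum defining the covering complexity exists because the ratios
    take finitely many values, the dimension of U being bounded and the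
    diameter being at most 12 X ([covering_complexity_le]). *)

Set Implicit Arguments.
Unset Strict Implicit.
Unset Printing Implicit Defensive.

Import Order.TTheory GRing.Theory Num.Theory.
Local Open Scope ring_scope.

(** * Conditions that hold generically *)

Section Generic.
Import VectorInternalTheory.
Variable F : numFieldType.

(** A property holding outside the roots of a nonzero polynomial.  Recording
    the polynomial makes the intersection of two such properties immediate. *)
Definition cofinite (P : F -> Prop) : Prop :=
  exists2 p : {poly F}, p != 0 & forall t, p.[t] != 0 -> P t.

Lemma cofinite_and (P Q : F -> Prop) :
  cofinite P -> cofinite Q -> cofinite (fun t => P t /\ Q t).
Proof.
move=> [p p0 hp] [q q0 hq]; exists (p * q); first by rewrite mulf_neq0.
by move=> t; rewrite hornerM mulf_eq0 negb_or => /andP[/hp ? /hq ?].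
Qed.

Lemma cofinite_neq0 : cofinite (fun t => t != 0).
Proof. by exists 'X; rewrite ?polyX_eq0 // => t; rewrite hornerX. Qed.

Lemma cofinite_ex (P : F -> Prop) : cofinite P -> exists t, P t.
Proof.
move=> [p p0 hp]; pose s : seq F := [seq i%:R | i <- iota 0 (size p)].
have us : uniq s.
  by rewrite map_inj_uniq ?iota_uniq // => i j /eqP; rewrite eqr_nat => /eqP.
have [/(max_poly_roots p0)|/allPn[t _ pt]] := boolP (all (root p) s).
  by move=> /(_ us); rewrite size_map size_iota ltnn.
by exists t; apply: hp.
Qed.

(** Testing against linear functionals spares the choice of a basis of [W] and
    makes stability under linear maps a composition. *)
Definition polynomial_path (W : vectType F) (c : F -> W) : Prop :=
  forall f : 'Hom(W, F^o), exists p : {poly F}, forall t, f (c t) = p.[t] :> F.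

Lemma polynomial_path_lin (V W : vectType F) (f : 'Hom(V, W)) (c : F -> V) :
  polynomial_path c -> polynomial_path (fun t => f (c t)).
Proof.
move=> hc g; have [p hp] := hc (g \o f)%VF.
by exists p => t; rewrite -hp comp_lfunE.
Qed.

Lemma polynomial_path_mx m n (P : 'M[{poly F}]_(m, n)) :
  polynomial_path (fun t => map_mx (horner_eval t) P).
Proof.
move=> f; exists (\sum_i \sum_j P i j * (f (delta_mx i j) : F)%:P) => t.
rewrite [in LHS](matrix_sum_delta (map_mx _ _)) linear_sum horner_sum.
apply: eq_bigr => i _; rewrite linear_sum horner_sum; apply: eq_bigr => j _.
by rewrite linearZ /= hornerM hornerC mxE.
Qed.

Definition line_mx m n (x v : 'M[F]_(m, n)) : 'M[{poly F}]_(m, n) :=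
  map_mx polyC x + 'X *: map_mx polyC v.

Lemma eval_line_mx m n (x v : 'M[F]_(m, n)) t :
  map_mx (horner_eval t) (line_mx x v) = x + t *: v.
Proof.
by apply/matrixP => i j; rewrite /line_mx !mxE /= /horner_eval !hornerE.
Qed.

Lemma polynomial_path_cst (W : vectType F) (w : W) : polynomial_path (fun=> w).
Proof. by move=> f; exists (f w : F)%:P => t; rewrite hornerC. Qed.

Lemma dim_span_mx (W : vectType F) n (X : n.-tuple W) :
  \dim <<X>> = \rank (b2mx X).
Proof.
case: X => X sX /=; move/eqP: (sX) => e; subst n.
by rewrite unlock /dimv /= genmxE; congr (\rank (b2mx _)); apply: val_inj.
Qed.

(** The rank is witnessed by the determinant of a compression rather than by
    a minor in given coordinates; since [P] and [Q] are constant, the same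
    pair can be used along a whole family of matrices. *)
Lemma rank_minor m n r (A : 'M[F]_(m, n)) : (r <= \rank A)%N ->
  exists (P : 'M_(r, m)) (Q : 'M_(n, r)), \det (P *m A *m Q) != 0.
Proof.
move=> rA.
exists (pid_mx r *m invmx (col_ebase A)), (invmx (row_ebase A) *m pid_mx r).
rewrite -{2}(mulmx_ebase A) !mulmxA mulmxKV ?col_ebase_unit //.
rewrite mulmxK ?row_ebase_unit //.
have rm := leq_trans rA (rank_leq_row A).
have rn := leq_trans rA (rank_leq_col A).
rewrite !mul_pid_mx (minn_idPl rA) (minn_idPr rm) minnn (minn_idPr rn).
by rewrite pid_mx_1 det1 oner_neq0.
Qed.

Lemma minor_rank m n r (A : 'M[F]_(m, n)) (P : 'M_(r, m)) (Q : 'M_(n, r)) :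
  \det (P *m A *m Q) != 0 -> (r <= \rank A)%N.
Proof.
rewrite -unitfE -unitmxE => /mxrank_unit rk; rewrite -{1}rk.
by rewrite (leq_trans (mxrankM_maxl _ _)) ?mxrankM_maxr.
Qed.

(** Along polynomial paths the determinant that witnesses the dimension at
    [t0] is a polynomial in [t], nonzero at [t0]. *)
Lemma dim_span_semicontinuous (W : vectType F) n (c : 'I_n -> F -> W) t0 :
  (forall i, polynomial_path (c i)) ->
  cofinite (fun t => (\dim <<[tuple c i t0 | i < n]>>
                     <= \dim <<[tuple c i t | i < n]>>)%N).
Proof.
move=> hc; pose A t := b2mx [tuple c i t | i < n].
have [B hB] : exists B : 'M[{poly F}]_(n, dim W),
    forall t, A t = map_mx (horner_eval t) B.
  have hB k j : exists p : {poly F}, forall t, A t k j = p.[t].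
    pose f : W -> F^o := fun w => v2r w 0 j.
    have fl : linear f by move=> a u v; rewrite /f linearP !mxE.
    pose fL : {linear W -> F^o} := HB.pack f (GRing.isLinear.Build _ _ _ _ f fl).
    have [p hp] := hc k (linfun fL); exists p => t.
    by rewrite -hp lfunE /A mxE tnth_mktuple.
  have [B hB'] := fin_all_exists (fun k => fin_all_exists (hB k)).
  by exists (\matrix_(k, j) B k j) => t; apply/matrixP => k j; rewrite hB' !mxE.
have [P [Q d0]] := rank_minor (leqnn (\rank (A t0))).
pose D := map_mx polyC P *m B *m map_mx polyC Q.
have hD t : (\det D).[t] = \det (P *m A t *m Q).
  rewrite -[LHS]/(horner_eval t _) -det_map_mx !map_mxM -hB -!map_mx_comp.
  congr (\det (_ *m _ *m _)); apply: map_mx_id => x /=;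
    by rewrite /horner_eval hornerC.
exists (\det D).
  by apply: contraNneq d0 => D0; rewrite -hD D0 horner0.
by move=> t; rewrite hD !dim_span_mx => /minor_rank.
Qed.

Lemma dim_sum_semicontinuous (W : vectType F) (J : finType)
    (c : J -> F -> W) t0 :
  (forall i, polynomial_path (c i)) ->
  cofinite (fun t => (\dim (\sum_i <[c i t0]>) <= \dim (\sum_i <[c i t]>))%N).
Proof.
move=> hc.
have E t : (\sum_i <[c i t]>)%VS = <<[tuple c (enum_val i) t | i < #|J|]>>%VS.
  rewrite span_def big_tuple (reindex _ (onW_bij _ (@enum_val_bij J))) /=.
  by apply: eq_bigr => i _; rewrite tnth_mktuple.
have [p p0 hp] := @dim_span_semicontinuous W #|J| (fun i => c (enum_val i)) t0
  (fun i => hc (enum_val i)).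
by exists p => // t /hp; rewrite !E.
Qed.

Lemma dim_lin_semicontinuous (V W : vectType F) (A : {vspace W}) (U : {vspace V})
    (f : F -> 'Hom(V, W)) t0 :
  (forall u, polynomial_path (fun t => f t u)) ->
  cofinite (fun t => (\dim (A + f t0 @: U) <= \dim (A + f t @: U))%N).
Proof.
move=> hf; pose c (i : 'I_(\dim A + \dim U)) t :=
  match split i with inl j => (vbasis A)`_j | inr j => f t (vbasis U)`_j end.
have hc i : polynomial_path (c i).
  by rewrite /c; case: split => j //; exact: polynomial_path_cst.
have E t : (A + f t @: U)%VS = <<[tuple c i t | i < _]>>%VS.
  rewrite -{1}(span_basis (vbasisP A)) -{1}(span_basis (vbasisP U)).
  rewrite limg_span -span_cat.
  congr (span _); apply: (@eq_from_nth _ 0).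
    by rewrite size_cat size_map !size_tuple.
  move=> i; rewrite size_cat size_map !size_tuple => hi.
  rewrite -(tnth_nth 0 (mktuple (c^~ t)) (Ordinal hi)) tnth_mktuple /c.
  rewrite nth_cat size_tuple; case: splitP => j /= ->; rewrite ?ltn_ord //.
  by rewrite ltnNge leq_addr addKn (nth_map 0) ?size_tuple.
have [p p0 hp] := dim_span_semicontinuous t0 hc.
by exists p => // t /hp; rewrite !E.
Qed.

(** An elementary substitute for a dense Zariski open set: openness is only
    asked along lines through points of the set.  Joining a point of one set
    to a point of another by a line shows that two such sets meet. *)
Definition generic (V : lmodType F) (P : V -> Prop) : Prop :=
  (exists x, P x) /\
  forall x y, P x -> cofinite (fun t => P (x + t *: (y - x))).

Lemma generic_and (V : lmodType F) (P Q : V -> Prop) :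
  generic P -> generic Q -> generic (fun x => P x /\ Q x).
Proof.
move=> [[x Px] hP] [[y Qy] hQ]; split; last first.
  by move=> u v [Pu Qu]; apply: cofinite_and; [exact: hP | exact: hQ].
have [p p0 hp] := hQ y x Qy.
have hq : cofinite (fun t => Q (x + t *: (y - x))).
  exists (p \Po (1 - 'X)).
    rewrite comp_poly_eq0 //; rewrite -opprB size_polyN.
    by rewrite -polyC1 size_XsubC.
  move=> t; rewrite horner_comp => /hp; rewrite !hornerE.
  by rewrite scalerBl scale1r -scalerN opprB addrA [y + (x - y)]addrC subrK.
have [t [? ?]] := cofinite_ex (cofinite_and (hP x y Px) hq).
by exists (x + t *: (y - x)).
Qed.

Lemma generic_all (V : lmodType F) (I : finType) (P : I -> V -> Prop) :
  (forall i, generic (P i)) -> generic (fun x => forall i, P i x).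
Proof.
move=> hP; suff: generic (fun x => forall i, i \in enum I -> P i x).
  move=> [[x hx] h]; split; first by exists x => i; apply: hx; rewrite mem_enum.
  move=> u v hu; have [//|p p0 hp] := h u v.
  by exists p => // t /hp ht i; apply: ht; rewrite mem_enum.
elim: (enum I) => [|i s IH].
  by split; [exists 0 | move=> *; exists 1; rewrite ?oner_eq0].
have [[x hx] h] := generic_and (hP i) IH; split.
  exists x => j; rewrite in_cons => /predU1P[->|]; first exact: hx.1.
  exact: hx.2.
move=> u v hu; have [|p p0 hp] := h u v.
  by split=> [|j js]; apply: hu; rewrite in_cons ?eqxx // js orbT.
exists p => // t /hp[ht1 ht2] j.
by rewrite in_cons => /predU1P[->|/ht2].
Qed.

Lemma generic_dim (X : lmodType F) (V W : vectType F) (A : {vspace W})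
    (U : {vspace V}) (f : X -> 'Hom(V, W)) r :
  (forall x y u, polynomial_path (fun t => f (x + t *: (y - x)) u)) ->
  (exists x, r <= \dim (A + f x @: U))%N ->
  generic (fun x => (r <= \dim (A + f x @: U))%N).
Proof.
move=> hf ex; split=> // x y hx.
have [p p0 hp] := dim_lin_semicontinuous A U 0 (hf x y).
by exists p => // t /hp; rewrite scale0r addr0; exact: leq_trans.
Qed.

Lemma generic_unitmx n : generic (fun x : 'M[F]_n => x \in unitmx).
Proof.
split; first by exists 1%:M; exact: unitmx1.
move=> x y ux; pose L := line_mx x (y - x).
have hL t : (\det L).[t] = \det (x + t *: (y - x)).
  by rewrite -[LHS]/(horner_eval t _) -det_map_mx eval_line_mx.
exists (\det L); last by move=> t; rewrite hL -unitfE -unitmxE.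
apply: contraTneq ux => L0.
by rewrite unitmxE unitfE -[x]addr0 -(scale0r (y - x)) -hL L0 horner0 eqxx.
Qed.
End Generic.

(** * Generic ranks on an irreducible representation *)

Section Slope.
Variables (K : fieldType) (H : groupType) (V W : vectType K).
Variable rho : linear_rep H V.
Hypothesis irr : irreducible_rep rho.
Variables (X : Type) (f : X -> 'Hom(V, W)) (act : X -> H -> X).
Hypothesis f_act : forall x h, (f x \o rho h)%VF = f (act x h).
Hypothesis f_max2 : forall (A B : {vspace V}) x y, exists z,
  (\dim (f x @: A) <= \dim (f z @: A))%N /\
  (\dim (f y @: B) <= \dim (f z @: B))%N.

(** If some map of the family has rank R on V, then some map has rank at least
    dim U * R / dim V on U.  The generic rank rk is submodular, because two
    subspaces attain their generic ranks for a common parameter, and it is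
    invariant under H.  So psi = N rk - R dim, shifted by the constant R N
    to stay in the natural numbers, is submodular and invariant.  If A
    minimises psi and is as large as possible, then A + h A also minimises psi,
    whence h A <= A: the subspace A is stable, hence 0 or V, and in both cases
    psi A is at least R N. *)
Lemma rank_slope (U : {vspace V}) x0 : exists x,
  (\dim (f x0 @: fullv) * \dim U <= \dim (f x @: U) * \dim {:V})%N.
Proof.
set R := \dim _; set N := \dim {:V}.
have rkP (A : {vspace V}) : exists r, (exists x, r = \dim (f x @: A)) /\
    forall x, (\dim (f x @: A) <= r)%N.
  pose P r := `[< exists x, r = \dim (f x @: A) >].
  have exP : exists r, P r by exists (\dim (f x0 @: A)); apply/asboolP; exists x0.
  have ubP r : P r -> (r <= \dim {:W})%N.
    by move=> /asboolP[x ->]; rewrite dimvS ?subvf.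
  case: (ex_maxnP exP ubP) => r /asboolP[x xr] hr; exists r.
  split; first by exists x.
  by move=> y; apply: hr; apply/asboolP; exists y.
have [rk rkE] := choice rkP.
pose psi A := (rk A * N + R * (N - \dim A))%N.
have dN (A : {vspace V}) : (\dim A <= N)%N by rewrite dimvS ?subvf.
suff psiU : (R * N <= psi U)%N.
  have [[x xr] _] := rkE U; exists x; rewrite -xr.
  have : (R * (N - \dim U) + R * \dim U = R * N)%N by rewrite -mulnDr subnK.
  by move: psiU; rewrite /psi; lia.
have [A [minA maxA]] : exists A : {vspace V}, (forall B, psi A <= psi B)%N /\
    forall B, psi B = psi A -> (\dim B <= \dim A)%N.
  pose P r := `[< exists A, r = (psi A * N.+1 + (N - \dim A))%N >].
  have exP : exists r, P r by eexists; apply/asboolP; exists U.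
  case: (ex_minnP exP) => r /asboolP[A ->] hr.
  have {}hr B : (psi A * N.+1 + (N - \dim A) <= psi B * N.+1 + (N - \dim B))%N.
    by apply: hr; apply/asboolP; exists B.
  exists A; split=> B; last first.
    by move=> e; move: (hr B); rewrite e leq_add2l leq_sub2lE.
  rewrite -ltnS -(ltn_pmul2r (ltn0Sn N)) mulSn addnC.
  apply: leq_ltn_trans (leq_trans (leq_addr _ _) (hr B)) _.
  by rewrite ltn_add2l ltnS leq_subr.
suff: A = 0%VS \/ A = fullv.
  move=> A0F; apply: leq_trans (minA U); rewrite /psi; case: A0F => ->.
    by rewrite dimv0 subn0 leq_addl.
  by rewrite subnn muln0 addn0 leq_mul2r (rkE _).2 orbT.
apply: irr.2 => h; set B := (rho h @: A)%VS.
have injh : (lker (rho h) == 0)%VS.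
  apply/lker0P => u v /(congr1 (rho h^-1%g)).
  by rewrite -!comp_lfunE -!repM mulVg !rep1 !id_lfunE.
have dB : \dim B = \dim A by apply: limg_dim_eq; rewrite (eqP injh) capv0.
have rkB : (rk B <= rk A)%N.
  by have [[x ->] _] := rkE B; rewrite -limg_comp f_act; apply: (rkE A).2.
have rkD : (rk (A + B)%VS + rk (A :&: B)%VS <= rk A + rk B)%N.
  have [[[x ex] _] [[y ey] _]] := (rkE (A + B)%VS, rkE (A :&: B)%VS).
  have [z [hx hy]] := f_max2 (A + B)%VS (A :&: B)%VS x y.
  rewrite ex ey (leq_trans (leq_add hx hy)) // limgD.
  apply: (@leq_trans (\dim (f z @: A + f z @: B)
                      + \dim (f z @: A :&: f z @: B))%N).
    by rewrite leq_add2l dimvS ?limg_cap.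
  by rewrite dimv_sum_cap leq_add ?(rkE _).2.
have psiB : psi B = psi A.
  by apply/eqP; rewrite eqn_leq minA andbT /psi dB leq_add2r leq_mul2r rkB orbT.
have psiD : (psi (A + B)%VS + psi (A :&: B)%VS <= psi A + psi B)%N.
  rewrite /psi addnACA [X in (_ <= X)%N]addnACA -!mulnDl -!mulnDr.
  rewrite leq_add ?leq_mul2r ?rkD ?orbT //.
  rewrite leq_mul2l; apply/orP; right.
  have := dimv_sum_cap A B; have := (dN A, dN B, dN (A + B)%VS, dN (A :&: B)%VS).
  move=> [[[]]]; lia.
have psiDA : psi (A + B)%VS = psi A.
  have := minA (A + B)%VS; have := minA (A :&: B)%VS.
  move: psiD; rewrite psiB; lia.
have AB : (A == A + B)%VS by rewrite eqEdim addvSl maxA.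
by rewrite (eqP AB) addvSr.
Qed.
End Slope.

(** * Covering a block of matrices row by row *)

(** A permutation of least cost sum S i * q (s i) works: exchanging two values
    in the wrong order would lower the cost. *)
Lemma antitone_perm (I : finType) (S q : I -> nat) :
  exists s : {perm I}, forall i j, (S i < S j)%N -> (q (s j) <= q (s i))%N.
Proof.
pose cost (s : {perm I}) := (\sum_i S i * q (s i))%N.
case: (@arg_minnP _ (1%g : {perm I}) predT cost isT) => s _ min_s.
exists s => i j Sij; rewrite leqNgt; apply/negP => qij.
have nij : j != i by apply: contraTneq Sij => ->; rewrite ltnn.
have := min_s (tperm i j * s)%g isT; apply/negP; rewrite -ltnNge /cost.
rewrite (bigD1 i) // [X in (_ < X)%N](bigD1 i) //=.
rewrite (bigD1 j) // [X in (_ < _ + X)%N](bigD1 j) //=.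
rewrite !permM tpermL tpermR.
rewrite (eq_bigr (fun k => S k * q (s k)))%N; last first.
  by move=> k /andP[ki kj]; rewrite permM tpermD // eq_sym.
rewrite !addnA ltn_add2r; nia.
Qed.

(** Greedy balancing: each new permutation gives the large values of [q] to the
    indices with small totals, so that two totals never differ by more than
    [b]. *)
Lemma balanced_perms (I : finType) (q : I -> nat) b m :
  (forall i, q i <= b)%N ->
  exists s : nat -> {perm I}, forall i i',
    (\sum_(j < m) q (s j i) <= \sum_(j < m) q (s j i') + b)%N.
Proof.
move=> qb; elim: m => [|m [s IH]].
  by exists (fun=> 1%g) => i i'; rewrite !big_ord0.
have [s1 hs1] := antitone_perm (fun i => \sum_(j < m) q (s j i))%N q.
exists (fun j => if j == m then s1 else s j) => i i'.
rewrite !big_ord_recr /= eqxx.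
have E k : (\sum_(j < m) q ((if j == m :> nat then s1 else s j) k)
            = \sum_(j < m) q (s j k))%N.
  by apply: eq_bigr => j _; rewrite ltn_eqF.
rewrite !E.
have [lt|ge] := ltnP (\sum_(j < m) q (s j i'))%N (\sum_(j < m) q (s j i))%N.
  by have := hs1 _ _ lt; have := IH i i'; lia.
have := qb (s1 i); lia.
Qed.

Section Position.
Variable F : numFieldType.

Lemma max_position (V : vectType F) (A B : {vspace V}) : exists f : 'End(V),
  (minn (\dim {:V}) (\dim A + \dim B) <= \dim (A + f @: B))%N.
Proof.
pose C := (A^C)%VS.
have dC : (\dim A + \dim C = \dim {:V})%N.
  by rewrite -dimv_disjoint_sum ?addv_complf ?capv_compl.
pose Y := take (\dim B) (vbasis C) ++ nseq (\dim B - \dim C) 0.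
have sY : size Y = size (vbasis B).
  rewrite size_cat size_take size_nseq !size_tuple; case: ltnP; lia.
have [f hf] := linear_of_free (vbasis B) Y.
have {}hf := hf (basis_free (vbasisP B)) sY.
exists (linfun f).
have -> : (linfun f @: B = <<take (\dim B) (vbasis C)>>)%VS.
  rewrite -{1}(span_basis (vbasisP B)) limg_span (eq_map (lfunE f)) hf /Y.
  rewrite span_cat.
  rewrite [<<nseq _ _>>%VS](_ : _ = 0%VS) ?addv0 //.
  apply/eqP; rewrite -subv0; apply/span_subvP => u /nseqP[-> _].
  exact: mem0v.
rewrite dimv_disjoint_sum; last first.
  apply/eqP; rewrite -subv0 -(capv_compl A) capvS //.
  by apply/span_subvP => u /mem_take; exact: vbasis_mem.
have [BC|CB] := leqP (\dim C) (\dim B).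
  by rewrite take_oversize ?size_tuple // (span_basis (vbasisP C)) dC geq_minl.
have : free (take (\dim B) (vbasis C)).
  have := basis_free (vbasisP C).
  by rewrite -{1}(cat_take_drop (\dim B) (vbasis C)) => /catl_free.
by rewrite /free => /eqP->; rewrite size_take size_tuple CB geq_minr.
Qed.

Definition rmul b (y : 'M[F]_b) : 'End('rV[F]_b) := linfun (mulmxr y).

Lemma rmulE b (y : 'M[F]_b) v : rmul y v = v *m y.
Proof. by rewrite lfunE. Qed.

(** A single [y] serves all indices at once, since each condition on [y] is
    generic. *)
Lemma general_position b (I : finType) (A B : I -> {vspace 'rV[F]_b}) :
  exists2 y : 'M[F]_b, y \in unitmx & forall i,
    (minn b (\dim (A i) + \dim (B i)) <= \dim (A i + rmul y @: B i))%N.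
Proof.
have gA i : generic (fun y : 'M[F]_b =>
    (minn b (\dim (A i) + \dim (B i)) <= \dim (A i + rmul y @: B i))%N).
  apply: generic_dim => [x y u|].
    have := polynomial_path_mx (line_mx (u *m x) (u *m (y - x))).
    congr polynomial_path; apply/funext => t.
    by rewrite eval_line_mx rmulE [RHS]mulmxDr -scalemxAr.
  have [f hf] := max_position (A i) (B i).
  exists (lin1_mx f); rewrite dimvf /dim /= mul1n in hf.
  rewrite (_ : rmul _ = f) //.
  by apply/lfunP => v; rewrite rmulE mul_rV_lin1.
have [[y [uy hy]] _] := generic_and (generic_unitmx F b) (generic_all gA).
by exists y.
Qed.

(** The row totals average at least 2 b and differ by at most b, so each of
    them is at least b, and general position turns this into a full sum. *)
Lemma row_spaces_cover a b m (Q : 'I_a -> {vspace 'rV[F]_b}) :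
  (2 * (a * b) <= m * \sum_i \dim (Q i))%N ->
  exists s : 'I_m -> 'S_a, exists2 y : 'I_m -> 'M[F]_b,
    forall j, y j \in unitmx &
    forall i, (\sum_j rmul (y j) @: Q (s j i))%VS = fullv.
Proof.
move=> hm.
have dF : \dim {:'rV[F]_b} = b by rewrite dimvf /dim /= mul1n.
have qb i : (\dim (Q i) <= b)%N by rewrite -[X in (_ <= X)%N]dF dimvS ?subvf.
have [s hs] := balanced_perms m qb.
have [y uy hy] : exists2 y : nat -> 'M[F]_b, forall j, y j \in unitmx & forall i,
   (minn b (\sum_(j < m) \dim (Q (s j i)))
      <= \dim (\sum_(j < m) rmul (y j) @: Q (s j i))%VS)%N.
  elim: {hm hs} m => [|m [y uy IH]].
    by exists (fun=> 1%:M) => [j|i]; [exact: unitmx1 | rewrite big_ord0 minn0].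
  have [z uz hz] := general_position
    (fun i => (\sum_(j < m) rmul (y j) @: Q (s j i))%VS) (fun i => Q (s m i)).
  exists (fun j => if j == m then z else y j) => [j|i]; first by case: ifP.
  rewrite !big_ord_recr /= eqxx.
  rewrite [X in (_ <= \dim (X + _))%N](eq_bigr
    (fun j : 'I_m => rmul (y j) @: Q (s j i))%VS).
    apply: leq_trans (hz i); move: (IH i).
    by move: (\dim _) (bigop _ _ _) (\dim _) => d S q; lia.
  by move=> j _; rewrite ltn_eqF.
exists (fun j => s j), (fun j => y j) => // i.
have Sb : (b <= \sum_(j < m) \dim (Q (s j i)))%N.
  have : (\sum_(k < a) \sum_(j < m) \dim (Q (s j k)) = m * \sum_k \dim (Q k))%N.
    rewrite exchange_big /= -[m in RHS]card_ord -sum_nat_const.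
    by apply: eq_bigr => j _; rewrite [RHS](reindex_inj (@perm_inj _ (s j))).
  move=> E; rewrite leqNgt; apply/negP => lt.
  have : (\sum_(k < a) \sum_(j < m) \dim (Q (s j k)) < \sum_(k < a) 2 * b)%N.
    rewrite (bigD1 i) // [X in (_ < X)%N](bigD1 i) //= -addSn.
    apply: leq_add; first by apply: leq_trans lt _; rewrite leq_pmull.
    apply: leq_sum => k _; rewrite mul2n -addnn.
    by rewrite (leq_trans (hs k i)) // leq_add2r ltnW.
  rewrite E sum_nat_const card_ord; lia.
apply/eqP; rewrite -dimv_leqif_eq ?subvf // eqn_leq dimvS ?subvf //= dF.
by rewrite (leq_trans _ (hy i)) // leq_min leqnn.
Qed.
End Position.

(** * Six conjugates of the corner block span sl_n *)

Section Trace.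
Variable F : fieldType.

(** The trace form is nondegenerate, so the dimension of [S] is the codimension
    of its orthogonal, which lies in the line of scalar matrices. *)
Lemma dim_of_trace_perp n (S : {vspace 'M[F]_n}) :
  (forall X, (forall Y, Y \in S -> \tr (X *m Y) = 0) -> is_scalar_mx X) ->
  (n * n <= (\dim S).+1)%N.
Proof.
move=> hS; pose f (X : 'M[F]_n) := \row_i \tr (X *m (vbasis S)`_i) : 'rV_(\dim S).
have fl : linear f.
  move=> a X Y; apply/rowP => i.
  by rewrite !mxE mulmxDl -scalemxAl mxtraceD mxtraceZ.
pose fL : {linear 'M[F]_n -> 'rV_(\dim S)} :=
  HB.pack f (GRing.isLinear.Build _ _ _ _ f fl).
have := limg_ker_dim (linfun fL) fullv; rewrite capfv dimvf /dim /= => E.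
rewrite -[X in (X <= _)%N]E; apply: (@leq_add _ _ 1); last first.
  by rewrite (leq_trans (dimvS (subvf _))) // dimvf /dim /= mul1n.
suff kS : (lker (linfun fL) <= <[1%:M]>)%VS.
  by rewrite (leq_trans (dimvS kS)) // dim_vline; case: (_ == _).
apply/subvP => X; rewrite memv_ker lfunE /= => /eqP fX.
have /is_scalar_mxP[x ->] : is_scalar_mx X.
  apply: hS => Y /coord_vbasis ->; rewrite mulmx_sumr linear_sum big1 // => i _.
  rewrite -scalemxAr /= mxtraceZ; move/rowP/(_ i): fX; rewrite !mxE => ->.
  by rewrite mulr0.
by rewrite -(scalemx1 _ x) memvZ ?memv_line.
Qed.

Lemma tr_mul_delta m n (A : 'M[F]_(m, n)) i j : \tr (A *m delta_mx i j) = A j i.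
Proof.
rewrite /mxtrace (bigD1 j) //= big1 => [|k kj]; rewrite !mxE.
  rewrite addr0 (bigD1 i) //= big1 => [|k ki]; rewrite !mxE.
    by rewrite !eqxx mulr1 addr0.
  by rewrite (negbTE ki) mulr0.
by rewrite big1 // => l _; rewrite !mxE (negbTE kj) andbF mulr0.
Qed.

Variables (a b : nat).
Definition ur_mx (Z : 'M[F]_(a, b)) : 'M_(a + b) := block_mx 0 Z 0 0.

Fact ur_mx_is_linear : linear ur_mx.
Proof.
by move=> k A B; rewrite /ur_mx scale_block_mx add_block_mx !scaler0 !addr0.
Qed.
HB.instance Definition _ :=
  GRing.isLinear.Build F 'M[F]_(a, b) 'M[F]_(a + b) _ ur_mx ur_mx_is_linear.

Lemma dlsubmx_eq0 (M : 'M[F]_(a + b)) :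
  (forall Z, \tr (M *m ur_mx Z) = 0) -> dlsubmx M = 0.
Proof.
move=> hM; apply/matrixP => i j.
rewrite [RHS]mxE -[RHS](hM (delta_mx j i)) -tr_mul_delta.
rewrite -{2}(submxK M) /ur_mx mulmx_block mxtrace_block !mulmx0 !addr0.
by rewrite mxtrace0 add0r.
Qed.

Definition lower_mx (C : 'M[F]_(b, a)) : 'M_(a + b) := block_mx 1%:M 0 C 1%:M.

Lemma lower_mx_unit C : lower_mx C \in unitmx.
Proof. by rewrite unitmxE det_lblock !det1 mulr1 unitr1. Qed.

Lemma invmx_lower C : invmx (lower_mx C) = lower_mx (- C).
Proof.
apply: (can_inj (mulKmx (lower_mx_unit C))); rewrite mulmxV ?lower_mx_unit //.
rewrite /lower_mx mulmx_block !mulmx0 !mul0mx !mul1mx !mulmx1 !addr0 add0r subrr.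
by rewrite -scalar_mx_block.
Qed.

(** Orthogonality to the corner conjugated by [lower_mx C] says that [X] maps
    the graph of [C], a subspace of dimension a, into itself; the conclusion
    is the equation expressing this invariance. *)
Lemma lower_perp (X : 'M[F]_(a + b)) C :
  (forall Z, \tr (X *m (lower_mx C *m ur_mx Z *m invmx (lower_mx C))) = 0) ->
  dlsubmx X + drsubmx X *m C = C *m ulsubmx X + C *m ursubmx X *m C.
Proof.
move=> hX; have : dlsubmx (invmx (lower_mx C) *m X *m lower_mx C) = 0.
  apply: dlsubmx_eq0 => Z; rewrite -[RHS](hX Z) -!mulmxA mxtrace_mulC.
  by rewrite !mulmxA.
rewrite invmx_lower -{1}(submxK X) /lower_mx !mulmx_block block_mxKdl.
rewrite !mul1mx !mulmx1 !mulNmx !mulmxDl !mulNmx addrACA -opprD => /eqP.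
by rewrite addrC subr_eq0 => /eqP.
Qed.
End Trace.

Section SixGraphs.
Variables (F : numFieldType) (a b : nat).
Hypotheses (a0 : (0 < a)%N) (ab : (a <= b)%N) (ba : (b <= a.+1)%N).

Let C0 : 'M[F]_(b, a) := \matrix_(i, j) ((i : nat) == j)%:R.
Let C1 : 'M[F]_(b, a) := \matrix_(i, j) (((i : nat) == j)%:R * i%:R).
Let C2 : 'M[F]_(b, a) := \matrix_(i, j) ((i : nat) == j.+1)%:R.
(** For a matrix preserving the graphs, 0 kills the lower left block, C0
    identifies the two diagonal blocks on the first a coordinates, C1 makes
    them diagonal, and C2, a shift, makes the diagonal constant and reaches the
    extra coordinate present when b = a + 1.  The doubled maps separate the
    linear terms of the invariance equations from the quadratic ones, and the
    quadratic ones kill the upper right block. *)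
Definition six_graphs : 6.-tuple 'M[F]_(b, a) :=
  [tuple 0; C0; 2%:R *: C0; C1; C2; 2%:R *: C2].

Let entE m n (A B : 'M[F]_(m, n)) : A = B -> forall i j, A i j = B i j.
Proof. by move=> ->. Qed.

Let col_sum p (Y : 'M[F]_(p, b)) (c : 'I_b -> F) i (k : 'I_b) :
  \sum_(l < b) Y i l * (((l : nat) == k)%:R * c l) = Y i k * c k.
Proof.
rewrite (bigD1 k) //= big1 => [|l lk]; first by rewrite eqxx mul1r addr0.
by rewrite -val_eqE in lk; rewrite (negbTE lk) mul0r mulr0.
Qed.

Let row_sum p (Y : 'M[F]_(a, p)) (c : F) (k : 'I_a) j :
  \sum_(l < a) ((k : nat) == l)%:R * c * Y l j = c * Y k j.
Proof.
rewrite (bigD1 k) //= big1 => [|l lk]; first by rewrite eqxx mul1r addr0.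
by rewrite eq_sym -val_eqE in lk; rewrite (negbTE lk) !mul0r.
Qed.

Let colC0 p (Y : 'M[F]_(p, b)) i (j : 'I_a) (k : 'I_b) :
  k = j :> nat -> (Y *m C0) i j = Y i k.
Proof.
move=> kj; rewrite !mxE -[RHS]mulr1 -(col_sum Y (fun=> 1)).
by apply: eq_bigr => l _; rewrite mxE kj mulr1.
Qed.

Let colC1 p (Y : 'M[F]_(p, b)) i (j : 'I_a) (k : 'I_b) :
  k = j :> nat -> (Y *m C1) i j = Y i k * k%:R.
Proof.
move=> kj; rewrite !mxE -(col_sum Y (fun l => l%:R)).
by apply: eq_bigr => l _; rewrite mxE kj.
Qed.

Let colC2 p (Y : 'M[F]_(p, b)) i (j : 'I_a) (k : 'I_b) :
  k = j.+1 :> nat -> (Y *m C2) i j = Y i k.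
Proof.
move=> kj; rewrite !mxE -[RHS]mulr1 -(col_sum Y (fun=> 1)).
by apply: eq_bigr => l _; rewrite mxE kj mulr1.
Qed.

Let rowC0 p (Y : 'M[F]_(a, p)) (i : 'I_b) j (k : 'I_a) :
  i = k :> nat -> (C0 *m Y) i j = Y k j.
Proof.
move=> ik; rewrite !mxE -[RHS]mul1r -(row_sum Y 1).
by apply: eq_bigr => l _; rewrite mxE ik mulr1.
Qed.

Let rowC1 p (Y : 'M[F]_(a, p)) (i : 'I_b) j (k : 'I_a) :
  i = k :> nat -> (C1 *m Y) i j = k%:R * Y k j.
Proof.
move=> ik; rewrite !mxE -(row_sum Y k%:R).
by apply: eq_bigr => l _; rewrite mxE ik.
Qed.

Let rowC2 p (Y : 'M[F]_(a, p)) (i : 'I_b) j (k : 'I_a) :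
  i = k.+1 :> nat -> (C2 *m Y) i j = Y k j.
Proof.
move=> ik; rewrite !mxE -[RHS]mul1r -(row_sum Y 1).
by apply: eq_bigr => l _; rewrite mxE ik eqSS mulr1.
Qed.

Lemma six_graphs_perp (X : 'M[F]_(a + b)) :
  (forall e Z, let d := lower_mx (tnth six_graphs e) in
     \tr (X *m (d *m ur_mx Z *m invmx d)) = 0) ->
  is_scalar_mx X.
Proof.
move=> hX; have h e := lower_perp (hX e).
set P := ulsubmx X in h; set R := ursubmx X in h; set T := drsubmx X in h.
have S0 : dlsubmx X = 0.
  by have := h 0; rewrite (tnth_nth 0) /= mulmx0 addr0 !mul0mx addr0.
(* At [C] the equation is T C - C P = C R C; doubling [C] multiplies the left
   hand side by 2 and the right hand side by 4. *)
have quad C : dlsubmx X + T *m C = C *m P + C *m R *m C ->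
   dlsubmx X + T *m (2%:R *: C)
     = 2%:R *: C *m P + 2%:R *: C *m R *m (2%:R *: C) ->
   T *m C = C *m P /\ C *m R *m C = 0.
  rewrite S0 !add0r -!scalemxAr -!scalemxAl => -> /eqP.
  rewrite scalerDr -subr_eq0 opprD addrACA subrr add0r -scalerBr scaler_eq0.
  rewrite pnatr_eq0 /= -[X in X - _]scale1r -scalerBl scaler_eq0 subr_eq0.
  rewrite (eqr_nat F 1 2) /= => /eqP E; rewrite E addr0; split=> //.
have [T0 R0] : T *m C0 = C0 *m P /\ C0 *m R *m C0 = 0.
  apply: quad; [have := h 1 | have := h (inord 2)];
    by rewrite (tnth_nth 0) ?inordK.
have [T2 R2] : T *m C2 = C2 *m P /\ C2 *m R *m C2 = 0.
  apply: quad; [have := h (inord 4) | have := h (inord 5)];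
    by rewrite (tnth_nth 0) ?inordK.
have T1 : T *m C1 = C1 *m P + C1 *m R *m C1.
  by have := h (inord 3); rewrite (tnth_nth 0) ?inordK //= S0 add0r.
have Rz : R = 0.
  apply/matrixP => i k; rewrite [RHS]mxE; have [ka|ka] := ltnP k a.
    have := entE R0 (widen_ord ab i) (Ordinal ka).
    rewrite (colC0 _ _ (k := k)) // (rowC0 _ _ (k := i)) //.
    by rewrite [X in _ = X -> _]mxE.
  (* The last column of [R], present when b = a + 1, is only reached by C2. *)
  have ka' : k = a :> nat by have := ltn_ord k; lia.
  have ib : (i.+1 < b)%N by have := ltn_ord k; have := ltn_ord i; lia.
  have ja : (a.-1 < a)%N by lia.
  have := entE R2 (Ordinal ib) (Ordinal ja).
  rewrite (colC2 _ _ (k := k)) ?(rowC2 _ _ (k := i)) //=; last by lia.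
  by rewrite [X in _ = X -> _]mxE.
have Pw i j : T (widen_ord ab i) (widen_ord ab j) = P i j.
  have := entE T0 (widen_ord ab i) j.
  by rewrite (colC0 _ _ (k := widen_ord ab j)) // (rowC0 _ _ (k := i)).
have Pd i j : i != j -> P i j = 0.
  move=> nij; have := entE T1 (widen_ord ab i) j.
  rewrite Rz mulmx0 mul0mx addr0 (colC1 _ _ (k := widen_ord ab j)) //.
  rewrite (rowC1 _ _ (k := i)) // Pw mulrC => /eqP.
  rewrite -subr_eq0 -mulrBl mulf_eq0 subr_eq0 eqr_nat => /orP[|/eqP//].
  by move=> /eqP ji; case/eqP: nij; apply: val_inj.
pose x := P (Ordinal a0) (Ordinal a0).
have Px j (ja : (j < a)%N) : P (Ordinal ja) (Ordinal ja) = x.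
  elim: j ja => [|j IH] ja; first by congr (P _ _); apply: val_inj.
  rewrite -(IH (ltnW ja)) -Pw.
  have := entE T2 (widen_ord ab (Ordinal ja)) (Ordinal (ltnW ja)).
  rewrite (colC2 _ _ (k := widen_ord ab (Ordinal ja))) //.
  by rewrite (rowC2 _ _ (k := Ordinal (ltnW ja))).
have PE : P = x%:M.
  apply/matrixP => i j; rewrite [RHS]mxE; case: (eqVneq i j) => [->|/Pd//].
  by case: j => j ja; rewrite Px.
have TE : T = x%:M.
  apply/matrixP => i k; rewrite [RHS]mxE; have [ka|ka] := ltnP k a.
    have := entE T0 i (Ordinal ka).
    rewrite PE mul_mx_scalar (colC0 _ _ (k := k)) // => ->.
    by rewrite !mxE mulr_natr.
  have ja : (a.-1 < a)%N by lia.
  have ka' : k = (Ordinal ja).+1 :> nat by have := ltn_ord k; rewrite /=; lia.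
  have := entE T2 i (Ordinal ja).
  rewrite PE mul_mx_scalar (colC2 _ _ (k := k)) // => ->.
  by rewrite !mxE mulr_natr -ka'.
apply/is_scalar_mxP; exists x.
rewrite -(submxK X) -/P -/R -/T PE Rz S0 TE; apply/esym; exact: scalar_mx_block.
Qed.
End SixGraphs.

(** * Conjugation and irreducibility of sl_n *)

Section Conj.
Variables (F : numClosedFieldType) (n : nat).
Hypothesis n0 : (0 < n)%N.

Definition conj_mx (c : 'M[F]_n) : 'End('M[F]_n) :=
  linfun (mulmxr (invmx c) \o mulmx c).

Lemma conj_mxE c A : conj_mx c A = c *m A *m invmx c.
Proof. by rewrite lfunE. Qed.

Lemma conj_mx_comp (c d : 'M[F]_n) A :
  c \in unitmx -> d \in unitmx -> conj_mx (c *m d) A = conj_mx c (conj_mx d A).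
Proof.
move=> uc ud; rewrite !conj_mxE.
suff -> : invmx (c *m d) = invmx d *m invmx c by rewrite !mulmxA.
have ucd : c *m d \in unitmx by rewrite unitmx_mul uc.
by apply: (can_inj (mulKmx ucd)); rewrite mulmxV // mulmxA mulmxK // mulmxV.
Qed.

Definition sl_val : 'Hom(sl F n, 'M[F]_n) := linfun (@vsval F _ (slspace F n)).

Lemma sl_valE u : sl_val u = vsval u.
Proof. by rewrite lfunE. Qed.

Lemma lker_sl_val : lker sl_val == 0%VS.
Proof. by apply/lker0P => u v; rewrite !sl_valE; exact: val_inj. Qed.

Lemma dim_sl_val U : \dim (sl_val @: U) = \dim U.
Proof. by apply: limg_dim_eq; rewrite (eqP lker_sl_val) capv0. Qed.

Lemma dim_sl : \dim {:sl F n} = (n * n).-1.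
Proof.
pose tr : 'Hom('M[F]_n, F^o) := linfun (mxtrace : 'M[F]_n -> F^o).
have surj : limg tr = fullv.
  apply/eqP; rewrite eqEsubv subvf; apply/subvP => x _.
  have -> : x = tr (x *: delta_mx (Ordinal n0) (Ordinal n0)).
    rewrite lfunE /= mxtraceZ -[delta_mx _ _]mul1mx tr_mul_delta mxE eqxx.
    by rewrite mulr1.
  by rewrite memv_img ?memvf.
have := limg_ker_dim tr fullv; rewrite capfv surj.
have -> : \dim {:F^o} = 1%N by rewrite dimvf.
have -> : \dim {:'M[F]_n} = (n * n)%N by rewrite dimvf.
have -> : \dim {:sl F n} = \dim (slspace F n) by rewrite dimvf.
by rewrite addn1 => <-.
Qed.

Lemma sl_val_conj (g : SL F n) U :
  (sl_val @: (conj_rep F n g @: U) = conj_mx g @: (sl_val @: U))%VS.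
Proof.
rewrite -!limg_comp; apply/(eq_in_limg (V := U)) => u _.
by rewrite !comp_lfunE !sl_valE conj_mxE lfunE.
Qed.

(** Conjugation is insensitive to scalars, and the determinant has an n-th
    root. *)
Lemma SL_of_unit (c : 'M[F]_n) : c \in unitmx ->
  exists g : SL F n, conj_mx g = conj_mx c.
Proof.
move=> uc; pose x := n.-root (\det c).
have xn : x ^+ n = \det c by rewrite rootCK.
have x0 : x != 0.
  apply: contraTneq uc => x0; rewrite unitmxE -xn x0 expr0n.
  by rewrite -[n]prednK //= unitr0.
have d1 : \det (x^-1 *: c) == 1.
  by rewrite detZ exprVn xn mulVr.
exists (MkSL d1); apply/lfunP => A; rewrite !conj_mxE /=.
rewrite invmxZ ?unitmxE ?(eqP d1) ?unitr1 // invrK.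
by rewrite -!scalemxAl -!scalemxAr scalerA mulVf ?scale1r.
Qed.

(** It is convenient to count conjugates by invertible matrices, indexed by
    any finite type, and to measure their sum inside the full matrix space;
    the successor accounts for the codimension of sl_n. *)
Lemma translates_cover_of_units (U : {vspace sl F n}) (I : finType)
    (c : I -> 'M[F]_n) :
  (forall i, c i \in unitmx) ->
  (n * n <= (\dim (\sum_i conj_mx (c i) @: (sl_val @: U))%VS).+1)%N ->
  translates_cover (conj_rep F n) U #|I|.
Proof.
move=> uc hd; have [g hg] := fin_all_exists (fun i => SL_of_unit (uc i)).
exists (fun k => g (enum_val k)); apply/eqP; rewrite eqEdim subvf /= dim_sl.
have -> : (\sum_(k < #|I|) conj_rep F n (g (enum_val k)) @: U
           = \sum_i conj_rep F n (g i) @: U)%VS.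
  by rewrite [RHS](reindex _ (onW_bij _ (@enum_val_bij I))).
rewrite -dim_sl_val limg_sum.
rewrite (eq_bigr (fun i => conj_mx (c i) @: (sl_val @: U))%VS).
  by rewrite -ltnS prednK ?muln_gt0 ?n0.
by move=> i _; rewrite -hg -sl_val_conj.
Qed.

End Conj.

Section Irreducible.
Variables (F : numClosedFieldType) (n : nat) (n1 : (1 < n)%N).

Section Invariant.
Variable W : {vspace 'M[F]_n}.
Hypothesis W_conj : forall g : 'M[F]_n,
  g \in unitmx -> (conj_mx g @: W <= W)%VS.
Local Notation E i j := (delta_mx i j : 'M[F]_n).

(** Conjugating by 1 + t E_ij gives A + t [E_ij, A] - t ^ 2 E_ij A E_ij, and
    the values t = 1 and t = -1 separate the two corrections, with
    E_ij A E_ij = A_ji E_ij. *)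
Lemma invariant_transvection A (i j : 'I_n) : A \in W -> i != j ->
  A j i *: E i j \in W /\ E i j *m A - A *m E i j \in W.
Proof.
move=> WA nij.
have EE : E i j *m E i j = 0 by rewrite mul_delta_mx_0 // eq_sym.
have EAE : E i j *m A *m E i j = A j i *: E i j.
  apply/matrixP => k l; rewrite !mxE (bigD1 i) //= big1 => [|p pi].
    rewrite !mxE (bigD1 j) //= big1 => [|q qj].
      rewrite !mxE !eqxx andbT addr0 addr0.
      by case: (_ == _); case: (_ == _); rewrite ?mulr0 ?mul0r ?mulr1 ?mul1r.
    by rewrite !mxE (negbTE qj) andbF mul0r.
  by rewrite !mxE (negbTE pi) mulr0.
pose N := E i j *m A - A *m E i j.
have step t : A - t ^+ 2 *: (A j i *: E i j) + t *: N \in W.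
  pose g := 1%:M + t *: E i j; pose h := 1%:M - t *: E i j.
  have gh : g *m h = 1%:M.
    rewrite /g /h mulmxDl mul1mx mulmxBr mulmx1 -scalemxAl -scalemxAr EE.
    by rewrite !scaler0 subr0 subrK.
  have [ug _] := mulmx1_unit gh.
  have := subvP (W_conj ug) _ (memv_img _ WA).
  rewrite conj_mxE /= (_ : invmx g = h); last first.
    by rewrite -[LHS]mulmx1 -gh mulmxA mulVmx ?mul1mx.
  congr (_ \in W); rewrite -EAE /N /g mulmxDl mul1mx -scalemxAl.
  rewrite mulmxDl -scalemxAl.
  rewrite /h !mulmxBr !mulmx1 -!scalemxAr !scalerBr scalerA -expr2.
  by rewrite [t *: _ - _ *: (_ *m _ *m _)]addrC addrACA [- _ + t *: _]addrC.
have h1 := step 1; have := memvD h1 (step (-1)).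
rewrite sqrrN expr1n !scale1r scaleN1r in h1 *.
rewrite addrACA subrr addr0 -mulr2n -scaler_nat => /(memvZ 2%:R^-1).
rewrite scalerA mulVf ?pnatr_eq0 // scale1r => hB; split.
  by have := memvB WA hB; rewrite opprB addrC subrK.
by have := memvB h1 hB; rewrite addrAC subrr add0r.
Qed.

Lemma delta_in_all (i j : 'I_n) : i != j -> E i j \in W ->
  forall k l : 'I_n, k != l -> E k l \in W.
Proof.
have flip p q : p != q -> E p q \in W -> E q p \in W.
  move=> pq Wpq; have [|+ _] := invariant_transvection (i := q) (j := p) Wpq.
    by rewrite eq_sym.
  by rewrite mxE !eqxx scale1r.
have chl p q r : p != q -> r != q -> E p q \in W -> E r q \in W.
  move=> pq rq Wpq; have [-> //|rp] := eqVneq r p.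
  have [_] := invariant_transvection Wpq rp.
  by rewrite mul_delta_mx mul_delta_mx_0 ?subr0 // eq_sym.
move=> ij Wij k l kl; have [kj|kj] := eqVneq k j.
  subst k; apply: (flip l); first by rewrite eq_sym.
  by apply: (chl i) => //; rewrite eq_sym.
apply: (flip l); first by rewrite eq_sym.
apply: (chl j k); first by rewrite eq_sym.
  by rewrite eq_sym.
by apply: (flip k) => //; apply: (chl i).
Qed.

(** A nonscalar matrix yields some E_ij in [W], through an off-diagonal entry
    or through two distinct diagonal ones; then all E_kl with k <> l and all
    E_kk - E_ll belong to [W], and only scalars are orthogonal to these. *)
Lemma invariant_dim A : A \in W -> ~~ is_scalar_mx A ->
  (n * n <= (\dim W).+1)%N.
Proof.
move=> WA nsA.
have [i [j [ij Wij]]] : exists i j, i != j /\ E i j \in W.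
  have [/existsP[i /existsP[j /andP[ij Aji]]]|/existsPn nd] :=
    boolP [exists i, exists j, (i != j) && (A j i != 0)].
    exists i, j; split=> //; have [h _] := invariant_transvection WA ij.
    by rewrite -[E i j](scalerK Aji) memvZ.
  have Ad i j : i != j -> A i j = 0.
    rewrite eq_sym => ij; apply/eqP.
    by move/existsPn/(_ i): (nd j); rewrite ij /= negbK.
  have [/existsP[i /existsP[j Aij]]|/existsPn nd2] :=
    boolP [exists i, exists j, A j j != A i i].
    have ij : i != j by apply: contraNneq Aij => ->.
    exists i, j; split=> //; have [_ h] := invariant_transvection WA ij.
    have nz : A j j - A i i != 0 by rewrite subr_eq0.
    rewrite -[E i j](scalerK nz) memvZ //; move: h; congr (_ \in W).
    rewrite scalerBl; congr (_ - _); apply/matrixP => k l; rewrite !mxE.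
      rewrite (bigD1 j) //= big1 => [|p pj]; rewrite !mxE.
        rewrite eqxx andbT addr0 mulrC.
        have [->|lj] := eqVneq l j; rewrite ?andbT //.
        by rewrite andbF mulr0 Ad ?mul0r // eq_sym.
      by rewrite (negbTE pj) andbF mul0r.
    rewrite (bigD1 i) //= big1 => [|p pi]; rewrite !mxE.
      rewrite eqxx /= addr0; have [->|ki] := eqVneq k i => //=.
      by rewrite mulr0 Ad ?mul0r.
    by rewrite (negbTE pi) mulr0.
  case/negP: nsA; apply/is_scalar_mxP.
  exists (A (Ordinal (ltnW n1)) (Ordinal (ltnW n1))).
  apply/matrixP => k l; rewrite !mxE; have [->|/Ad//] := eqVneq k l.
  by move/existsPn/(_ l): (nd2 (Ordinal (ltnW n1))); rewrite negbK => /eqP.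
have all := delta_in_all ij Wij.
apply: dim_of_trace_perp => X hX.
have Xd k l : k != l -> X k l = 0.
  by move=> kl; rewrite -tr_mul_delta hX // all // eq_sym.
apply/is_scalar_mxP; exists (X (Ordinal (ltnW n1)) (Ordinal (ltnW n1))).
apply/matrixP => k l; rewrite !mxE; have [->|/Xd//] := eqVneq k l.
set o := Ordinal _; have [->//|lo] := eqVneq l o.
have ol : o != l by rewrite eq_sym.
have [_ /hX] := invariant_transvection (all _ _ lo) ol.
rewrite !mul_delta_mx mulmxBr linearB /= !tr_mul_delta => /eqP.
by rewrite subr_eq0 => /eqP->.
Qed.

End Invariant.

Lemma sl_irreducible : irreducible_rep (conj_rep F n).
Proof.
have n0 := ltnW n1; split.
  move=> F0; have := dim_sl F n0; rewrite F0 dimv0; nia.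
move=> W invW; have [->|W0] := eqVneq W 0%VS; [by left | right].
have W_conj c : c \in unitmx ->
    (conj_mx c @: (sl_val F n @: W) <= sl_val F n @: W)%VS.
  by move=> uc; have [g <-] := SL_of_unit n0 uc; rewrite -sl_val_conj limgS.
apply/eqP; rewrite eqEdim subvf /= dim_sl // -dim_sl_val.
have := invariant_dim W_conj (memv_img _ (memv_pick W)); rewrite sl_valE => h.
rewrite -ltnS prednK ?muln_gt0 ?n0 //; apply: h.
apply: contra W0 => /is_scalar_mxP[x ex].
have : \tr (vsval (vpick W)) = 0 by apply/eqP; rewrite -mem_slspace subvsP.
rewrite ex mxtrace_scalar => /eqP; rewrite mulrn_eq0 eqn0Ngt n0 /= => /eqP x0.
by rewrite -vpick0; apply/eqP/val_inj; rewrite /= ex x0 raddf0.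
Qed.
End Irreducible.

(** * The corner block of a general conjugate *)

Section RowFiltration.
Variables (F : fieldType) (V : vectType F) (a b : nat).
Variable p : 'Hom(V, 'M[F]_(a, b)).
Variable U : {vspace V}.

Definition row_of (i : 'I_a) : 'Hom(V, 'rV[F]_b) := (linfun (row i) \o p)%VF.
(** Filtering [U] by the vanishing of the first rows of its image makes the
    leading rows into the graded pieces of [p @: U]. *)
Definition rows_from (k : nat) : {vspace V} :=
  (U :&: \bigcap_(i < a | (i < k)%N) lker (row_of i))%VS.
Definition leading_row (i : 'I_a) : {vspace 'rV[F]_b} :=
  (row_of i @: rows_from i)%VS.

Lemma row_ofE i u : row_of i u = row i (p u).
Proof. by rewrite comp_lfunE lfunE. Qed.

Lemma rows_fromP k u :
  reflect (u \in U /\ forall i : 'I_a, (i < k)%N -> row i (p u) = 0)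
          (u \in rows_from k).
Proof.
apply: (iffP idP) => [|[uU h]].
  rewrite memv_cap => /andP[uU]; rewrite memvE => /subv_bigcapP h.
  split=> // i ik.
  by move: (h i ik); rewrite -memvE memv_ker row_ofE => /eqP.
rewrite memv_cap uU memvE; apply/subv_bigcapP => i ik.
by rewrite -memvE memv_ker row_ofE h.
Qed.

Lemma sum_leading_row : (\sum_i \dim (leading_row i) = \dim (p @: U))%N.
Proof.
have step k (ka : (k <= a)%N) :
    (\dim (rows_from k) + \sum_(i < a | (i < k)%N) \dim (leading_row i)
     = \dim U)%N.
  elim: k ka => [|k IH] ka.
    rewrite !big1 ?addn0 //; congr (\dim _).
    by apply/vspaceP => u; apply/rows_fromP/idP => [[]|].
  rewrite -{}IH ?(ltnW ka) // -(limg_ker_dim (row_of (Ordinal ka)) (rows_from k)).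
  rewrite (bigD1 (Ordinal ka)) //= -addnA; congr (_ + (_ + _))%N.
    congr (\dim _); apply/vspaceP => u; rewrite memv_cap memv_ker row_ofE.
    apply/rows_fromP/andP => [[uU h]|[/rows_fromP[uU h] /eqP h1]].
      split; last by rewrite h.
      by apply/rows_fromP; split=> // i ik; apply: h; exact: ltnW.
    split=> // i; rewrite ltnS leq_eqVlt => /predU1P[ik|/h//].
    by rewrite -h1; congr (row _ _); apply: val_inj.
  by apply: eq_bigl => i; rewrite ltnS -val_eqE /=; lia.
have E : (\sum_(i < a | (i < a)%N) \dim (leading_row i)
          = \sum_i \dim (leading_row i))%N.
  by apply: eq_bigl => i; rewrite ltn_ord.
have := step a (leqnn a); rewrite E -(limg_ker_dim p U).
suff -> : rows_from a = (U :&: lker p)%VS by move/addnI.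
apply/vspaceP => u; rewrite memv_cap memv_ker.
apply/rows_fromP/andP => [[uU h]|[uU /eqP pu]].
  by split=> //; apply/eqP/row_matrixP => i; rewrite h ?ltn_ord // row0.
by split=> // i _; rewrite pu row0.
Qed.
End RowFiltration.

Section Corner.
Variables (F : numClosedFieldType) (a b : nat).
Local Notation n := (a + b)%N.

(** Conjugation up to the factor [\det g], in a form polynomial in [g]. *)
Definition adj_conj (g : 'M[F]_n) : 'End('M[F]_n) :=
  linfun (mulmxr (\adj g) \o mulmx g).

Lemma adj_conjE g A : adj_conj g A = g *m A *m \adj g.
Proof. by rewrite lfunE. Qed.

Lemma adj_conj_unit g A : g \in unitmx -> adj_conj g A = \det g *: conj_mx g A.
Proof.
move=> ug; rewrite adj_conjE conj_mxE /invmx ug.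
by rewrite -scalemxAr scalerA mulrV ?scale1r.
Qed.

Definition corner (g : 'M[F]_n) : 'Hom(sl F n, 'M[F]_(a, b)) :=
  (linfun (rsubmx \o usubmx) \o adj_conj g \o sl_val F n)%VF.

Lemma cornerE g u : corner g u = ursubmx (adj_conj g (vsval u)).
Proof. by rewrite !comp_lfunE sl_valE [LHS]lfunE. Qed.

Lemma polynomial_path_corner x y u :
  polynomial_path (fun t => corner (x + t *: (y - x)) u).
Proof.
pose L := line_mx x (y - x).
have := polynomial_path_lin (linfun (rsubmx \o usubmx))
  (polynomial_path_mx (L *m map_mx polyC (vsval u) *m \adj L)).
congr polynomial_path; apply/funext => t.
rewrite cornerE lfunE /= adj_conjE -eval_line_mx.
rewrite !map_mxM map_mx_adj -map_mx_comp; congr (ursubmx (_ *m _ *m _)).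
by apply: map_mx_id => z /=; rewrite /horner_eval hornerC.
Qed.

(** [rank_slope] for the projections to the corner, parametrised by invertible
    matrices on which SL_n acts by right multiplication; at the identity the
    projection maps sl_n onto all a x b matrices. *)
Lemma large_corner (U : {vspace sl F n}) : (1 < n)%N ->
  exists2 g : 'M[F]_n, g \in unitmx &
    (a * b * \dim U <= \dim (corner g @: U) * (n * n).-1)%N.
Proof.
move=> n1.
have gen (A : {vspace sl F n}) x :
    generic (fun g => (\dim (corner x @: A) <= \dim (corner g @: A))%N).
  have -> : (fun g => (\dim (corner x @: A) <= \dim (corner g @: A))%N : Prop)
      = (fun g => (\dim (corner x @: A) <= \dim (0 + corner g @: A))%N).
    by apply/funext => g; rewrite add0v.
  by apply: generic_dim polynomial_path_corner _; exists x; rewrite add0v.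
pose X := {g : 'M[F]_n | g \in unitmx}; pose f (x : X) := corner (val x).
have unit_act (x : X) (h : SL F n) : val x *m h \in unitmx.
  by rewrite unitmx_mul (valP x) SL_unit.
pose act (x : X) (h : SL F n) : X := Sub (val x *m h) (unit_act x h).
have f_act x h : (f x \o conj_rep F n h)%VF = f (act x h).
  apply/lfunP => u; rewrite comp_lfunE /f !cornerE.
  have -> : vsval (conj_rep F n h u) = conj_mx h (vsval u).
    by rewrite conj_mxE lfunE.
  rewrite !adj_conj_unit ?(valP x) ?(valP (act x h)) //=.
  rewrite conj_mx_comp ?SL_unit ?(valP x) //.
  by rewrite det_mulmx SL_det mulr1.
have f_max (A B : {vspace sl F n}) x y : exists z,
    (\dim (f x @: A) <= \dim (f z @: A))%N /\
    (\dim (f y @: B) <= \dim (f z @: B))%N.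
  have [[z [uz [hA hB]]] _] := generic_and (generic_unitmx F n)
    (generic_and (gen A (val x)) (gen B (val y))).
  by exists (Sub z uz).
have [x hx] := rank_slope (sl_irreducible F n1) f_act f_max U
  (Sub 1%:M (unitmx1 _ _)).
exists (val x); first exact: valP.
move: hx; rewrite dim_sl ?(ltnW n1) // (_ : limg _ = fullv).
  have -> : \dim {:'M[F]_(a, b)} = (a * b)%N by rewrite dimvf.
  by [].
apply/eqP; rewrite eqEsubv subvf; apply/subvP => Z _.
have trZ : ur_mx Z \in slspace F n.
  by rewrite mem_slspace mxtrace_block !mxtrace0 addr0.
have -> : Z = corner 1%:M (Subvs trZ).
  by rewrite cornerE adj_conjE adj1 mulmx1 mul1mx block_mxKur.
by rewrite memv_img ?memvf.
Qed.

End Corner.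

(** * Degeneration to the leading rows *)

Section Degeneration.
Variables (F : numClosedFieldType) (a b : nat).
Local Notation n := (a + b)%N.

(** Conjugation by the torus scales entry (x, y) by s ^ (weight x - weight y).
    The gap 2 n makes the corner block the most negative part, and the
    weights 0, 1, ..., a - 1 order its rows. *)
Definition weight (x : 'I_n) : nat := if (x < a)%N then nat_of_ord x else n.*2.
Definition torus (s : F) : 'M[F]_n := diag_mx (\row_x s ^+ weight x).

(** The conjugate by the torus multiplied by s ^ (2 n - i), which clears the
    pole coming from row i of the corner.  The truncated subtraction in the
    exponent matters only for the entries of the corner above row i, which
    vanish wherever this matrix is used. *)
Definition rescaled (i : nat) (M : 'M[F]_n) : 'M[{poly F}]_n :=
  \matrix_(x, y) ((M x y)%:P * 'X^(n.*2 + weight x - (weight y + i))).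

Lemma torus_unit s : s != 0 -> torus s \in unitmx.
Proof.
move=> s0; rewrite unitmxE det_diag unitfE; apply/prodf_neq0 => x _.
by rewrite mxE expf_neq0.
Qed.

Lemma rescaled_torus (i : 'I_a) M s : s != 0 ->
  (forall k : 'I_a, (k < i)%N -> row k (ursubmx M) = 0) ->
  map_mx (horner_eval s) (rescaled i M)
    = s ^+ n.*2 / s ^+ i *: conj_mx (torus s) M.
Proof.
move=> s0 hM; have us := torus_unit s0.
apply: (can_inj (mulmxK us)); rewrite conj_mxE -scalemxAl mulmxKV //.
apply/matrixP => x y; rewrite /torus mul_mx_diag mxE [RHS]mxE mul_diag_mx.
rewrite !mxE /= /horner_eval hornerM hornerC hornerXn.
have [Mxy|Mxy] := eqVneq (M x y) 0; first by rewrite Mxy !(mul0r, mulr0).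
rewrite -mulrA -exprD.
have le : (weight y + i <= n.*2 + weight x)%N.
  rewrite /weight; case: ifP => ya; case: ifP => xa;
    try by have := ltn_ord i; lia.
  rewrite leqNgt; apply/negP => lt; have xi : (x < i)%N by lia.
  case/eqP: Mxy.
  have yb : (y - a < b)%N by have := ltn_ord y; lia.
  have := hM (Ordinal xa) xi => /rowP/(_ (Ordinal yb)); rewrite !mxE => <-.
  congr (M _ _); apply: val_inj => //=; lia.
apply: (mulIf (expf_neq0 i s0)).
rewrite -mulrA -exprD -addnA subnK // [RHS]mulrAC divfK ?expf_neq0 //.
by rewrite mulrA -exprD mulrC.
Qed.

(** In the limit only the leading row survives: all the other entries are
    either zero or carry a positive power of s. *)
Lemma rescaled0 (i : 'I_a) M :
  (forall k : 'I_a, (k < i)%N -> row k (ursubmx M) = 0) ->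
  map_mx (horner_eval 0) (rescaled i M)
    = ur_mx (delta_mx i 0 *m row i (ursubmx M)).
Proof.
move=> hM; apply/matrixP => x y.
rewrite mxE /= /horner_eval mxE hornerM hornerC hornerXn expr0n.
rewrite /ur_mx -[x]splitK -[y]splitK.
case: (split x) => x'; case: (split y) => y'; rewrite /=.
- rewrite block_mxEul mxE /weight /= !ltn_ord.
  rewrite (_ : _ == 0%N = false) ?mulr0 //.
  by move: (ltn_ord i) (ltn_ord x') (ltn_ord y'); lia.
- rewrite block_mxEur !mxE big_ord1 !mxE /weight /= ltn_ord ltnNge leq_addr /=.
  rewrite eqxx andbT.
  have [->|xi] := eqVneq x' i.
    by rewrite (_ : _ == 0%N) ?mulr1 ?mul1r //; lia.
  have [lt|ge] := ltnP x' i.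
    by move/rowP/(_ y'): (hM _ lt); rewrite !mxE => ->; rewrite !mul0r.
  rewrite -val_eqE /= in xi; rewrite (_ : _ == 0%N = false) ?mulr0 ?mul0r //.
  by move: (ltn_ord x') (ltn_ord y'); lia.
- rewrite block_mxEdl mxE /weight /= ltn_ord ltnNge leq_addr /=.
  rewrite (_ : _ == 0%N = false) ?mulr0 //.
  by move: (ltn_ord i) (ltn_ord x') (ltn_ord y'); lia.
- rewrite block_mxEdr mxE /weight /= !ltnNge !leq_addr /=.
  rewrite (_ : _ == 0%N = false) ?mulr0 //.
  by move: (ltn_ord i) (ltn_ord x') (ltn_ord y'); lia.
Qed.

End Degeneration.

(** * Covering sl_n with conjugates of a subspace *)

Section Cover.
Variables (F : numClosedFieldType) (a b : nat).
Local Notation n := (a + b)%N.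
Hypotheses (a0 : (0 < a)%N) (ab : (a <= b)%N) (ba : (b <= a.+1)%N).

Definition block_perm (s : 'S_a) (y : 'M[F]_b) : 'M[F]_n :=
  block_mx (perm_mx s) 0 0 (invmx y).

Lemma block_perm_unit s y : y \in unitmx -> block_perm s y \in unitmx.
Proof.
by move=> uy; rewrite unitmxE det_ublock unitrM -!unitmxE unitmx_perm unitmx_inv.
Qed.

Lemma conj_block_perm s y Z : y \in unitmx ->
  conj_mx (block_perm s y) (ur_mx Z) = ur_mx (row_perm s Z *m y).
Proof.
move=> uy; have uc := block_perm_unit s uy.
apply: (can_inj (mulmxK uc)); rewrite conj_mxE mulmxKV // /block_perm /ur_mx.
by rewrite !mulmx_block !mulmx0 !mul0mx !addr0 ?add0r mulmxK // row_permE.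
Qed.

(** One path for each of the 6 m conjugating matrices, each row and each basis
    vector of the corresponding step of the filtration.  At t = 0 the paths
    span the six conjugates of the whole corner, so their span has at least
    the dimension of sl_n; the same is then true for some t <> 0, where the
    paths lie in conjugates of [U]. *)
Lemma corner_cover (U : {vspace sl F n}) (g : 'M[F]_n) m :
  g \in unitmx -> (2 * (a * b) <= m * \dim (corner g @: U))%N ->
  translates_cover (conj_rep F n) U (6 * m).
Proof.
move=> ug; rewrite -sum_leading_row => /row_spaces_cover[s [y uy full]].
pose p := corner g; pose rows := rows_from p U.
pose d e := lower_mx (tnth (six_graphs F a b) e).
pose z (ej : 'I_6 * 'I_m) := d ej.1 *m block_perm (s ej.2) (y ej.2).
have uz ej : z ej \in unitmx.
  by rewrite unitmx_mul lower_mx_unit block_perm_unit ?uy.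
(* Indices beyond the dimension of the step give the zero vector. *)
pose v (i : 'I_a) (l : 'I_(\dim {:sl F n})) := (vbasis (rows i))`_l.
have v_in (i : 'I_a) l : v i l \in rows i.
  rewrite /v; have [lt|ge] := ltnP l (\dim (rows i)).
    by rewrite vbasis_mem // mem_nth ?size_tuple.
  by rewrite nth_default ?size_tuple ?mem0v.
have v_lead (i : 'I_a) l (k : 'I_a) : (k < i)%N ->
    row k (ursubmx (adj_conj g (vsval (v i l)))) = 0.
  by move=> ki; have /rows_fromP[_ h] := v_in i l; rewrite -cornerE h.
pose path (q : ('I_6 * 'I_m) * ('I_a * 'I_(\dim {:sl F n}))) (t : F) :=
  conj_mx (z q.1) (map_mx (horner_eval t)
    (rescaled q.2.1 (adj_conj g (vsval (v q.2.1 q.2.2))))).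
have path_poly q : polynomial_path (path q).
  by apply: polynomial_path_lin; exact: polynomial_path_mx.
have [t [t0 ht]] := cofinite_ex
  (cofinite_and (cofinite_neq0 F) (dim_sum_semicontinuous 0 path_poly)).
suff span0 : (n * n <= (\dim (\sum_q <[path q 0%R]>)%VS).+1)%N.
  have n0 : (0 < n)%N by rewrite addn_gt0 a0.
  pose I : finType := ('I_6 * 'I_m)%type.
  have -> : (6 * m = #|I|)%N by rewrite card_prod !card_ord.
  pose c ej := z ej *m torus a b t *m g.
  have uc ej : c ej \in unitmx by rewrite /c 2!unitmx_mul uz torus_unit.
  apply: (translates_cover_of_units n0 uc).
  apply: (leq_trans span0); rewrite ltnS (leq_trans ht) //.
  apply/dimvS/subv_sumP => -[ej [i l]] _; rewrite -memvE /path /=.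
  rewrite (rescaled_torus t0) => [|k]; last exact: v_lead.
  rewrite adj_conj_unit // !linearZ /= !memvZ //.
  have ut : torus a b t \in unitmx by exact: torus_unit.
  have uzt : z ej *m torus a b t \in unitmx by rewrite unitmx_mul uz.
  rewrite -(conj_mx_comp _ (uz ej) ut) -(conj_mx_comp _ uzt ug) -/(c ej).
  apply: (subvP (sumv_sup ej _ (subvv _))) => //.
  have /rows_fromP[vU _] := v_in i l.
  by rewrite memv_img // -sl_valE memv_img.
set S := (\sum_q <[path q 0%R]>)%VS.
pose place e (i : 'I_a) : 'Hom('rV[F]_b, 'M[F]_n) :=
  linfun (conj_mx (d e) \o @ur_mx F a b \o mulmx (delta_mx i 0)).
have placeE e (i : 'I_a) r :
    place e i r = conj_mx (d e) (ur_mx (delta_mx i 0 *m r)).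
  by rewrite lfunE.
(* Conjugation by [block_perm] puts the leading row space of index s j i,
   multiplied by y j, into row i; these spaces sum to all row vectors. *)
have placeS e (i : 'I_a) : (limg (place e i) <= S)%VS.
  rewrite -(full i) limg_sum; apply/subv_sumP => j _.
  rewrite /leading_row -(span_basis (vbasisP (rows_from _ _ _))) !limg_span.
  apply/span_subvP => _ /mapP[_ /mapP[_ /mapP[u uB ->] ->] ->].
  have lt : (index u (vbasis (rows (s j i))) < \dim {:sl F n})%N.
    apply: leq_trans (dimvS (subvf (rows (s j i)))).
    by rewrite -[X in (_ < X)%N](size_tuple (vbasis (rows _))) index_mem.
  have -> : place e i (rmul (y j) (row_of (corner g) (s j i) u))
      = path ((e, j), (s j i, Ordinal lt)) 0.
    have vu : v (s j i) (Ordinal lt) = u by rewrite /v nth_index.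
    rewrite /path /= rescaled0; last exact: v_lead.
    rewrite vu -cornerE placeE rmulE row_ofE.
    rewrite conj_mx_comp ?lower_mx_unit ?block_perm_unit //.
    rewrite conj_block_perm // mulmxA; congr (conj_mx _ (ur_mx (_ *m _))).
    rewrite row_permE mulmxA -row_permE; congr (_ *m _).
    by apply/matrixP => k l; rewrite !mxE (inj_eq perm_inj).
  apply: (subvP (sumv_sup ((e, j), (s j i, Ordinal lt)) _ (subvv _))) => //.
  exact: memv_line.
apply: dim_of_trace_perp => X hX; apply: (six_graphs_perp a0 ab ba) => e Z /=.
rewrite -conj_mxE; apply: hX.
have -> : Z = \sum_i delta_mx i 0 *m row i Z.
  rewrite [LHS]matrix_sum_delta; apply: eq_bigr => i _.
  rewrite [row i Z]row_sum_delta mulmx_sumr; apply: eq_bigr => j _.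
  by rewrite mxE -scalemxAr mul_delta_mx.
rewrite !linear_sum memv_suml // => i _.
have := subvP (placeS e i) _ (memv_img _ (memvf (row i Z))).
by rewrite placeE.
Qed.
End Cover.

(** * The covering complexity *)

Lemma ex_max_of_finite d (T : orderType d) (s : seq T) (P : T -> Prop) :
  (exists r, P r) -> (forall r, P r -> r \in s) ->
  exists2 r, P r & forall r', P r' -> (r' <= r)%O.
Proof.
elim: s P => [|x s IH] P [r Pr] hs; first by have := hs _ Pr.
have [[r' [Pr' xr']]|no] := pselect (exists r', P r' /\ (x < r')%O).
  have [|r1 [Pr1 lt1]|r2 [Pr2 xr2] max2] := IH (fun r => P r /\ (x < r)%O).
  - by exists r'.
  - by have := hs _ Pr1; rewrite in_cons gt_eqF.
  exists r2 => // u Pu; have [/(conj Pu)/max2//|ux] := ltP x u.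
  exact: le_trans ux (ltW xr2).
have Px u : P u -> (u <= x)%O.
  by move=> Pu; rewrite leNgt; apply/negP => xu; apply: no; exists u.
have [Pxx|nPx] := pselect (P x); first by exists x.
apply: IH; first by exists r.
move=> u Pu; have := hs _ Pu; rewrite in_cons => /predU1P[ux|//].
by rewrite ux in Pu.
Qed.

Section Complexity.
Variables (K : fieldType) (H : groupType) (V : vectType K).
Variable rho : linear_rep H V.

Definition ceil_ratio (U : {vspace V}) : nat :=
  `|Num.ceil ((\dim {:V})%:R / (\dim U)%:R : rat)|%N.

Lemma ceil_ratioP (U : {vspace V}) : U <> 0%VS ->
  [/\ (Num.ceil ((\dim {:V})%:R / (\dim U)%:R : rat)) = ceil_ratio U,
      (0 < ceil_ratio U)%N & (\dim {:V} <= ceil_ratio U * \dim U)%N].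
Proof.
move=> /eqP U0; have d0 : (0 < \dim U)%N by rewrite lt0n dimv_eq0.
have N0 : (0 < \dim {:V})%N by rewrite (leq_trans d0) // dimvS ?subvf.
set x := (_ / _ : rat).
have x0 : 0 < x by rewrite divr_gt0 ?ltr0n.
have c0 : 0 < Num.ceil x by rewrite ceil_gt0.
have E : Num.ceil x = ceil_ratio U :> int by rewrite /ceil_ratio gtz0_abs.
split=> //; first by rewrite -ltz_nat -E.
have := ceil_ge x; rewrite E /x ler_pdivrMr ?ltr0n // -pmulrn -natrM ler_nat.
exact.
Qed.

(** The bound on the diameters also gives the existence of the maximum: the
    ratio is determined by the dimension of [U] and by a diameter at most
    B * ceil_ratio U, so it takes finitely many values. *)
Lemma covering_complexity_le (B : nat) : irreducible_rep rho ->
  (forall U : {vspace V},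
     U <> 0%VS -> translates_cover rho U (B * ceil_ratio U)) ->
  exists2 c, is_covering_complexity rho c & c <= B%:R.
Proof.
move=> irr cov.
have ratio_ex (U : {vspace V}) : U <> 0%VS -> exists r, is_covering_ratio rho U r.
  move=> U0; pose P k := `[< translates_cover rho U k >].
  have exP : exists k, P k by eexists; apply/asboolP; exact: cov.
  case: (ex_minnP exP) => m /asboolP hm min_m; eexists; exists m; last by [].
  by split=> // k /asboolP/min_m.
have ratioP U r : U <> 0%VS -> is_covering_ratio rho U r ->
    exists2 m, (m <= B * ceil_ratio U)%N & r = m%:R / (ceil_ratio U)%:R.
  move=> U0 [m [_ min_m] ->]; exists m; first exact/min_m/cov.
  by have [-> _ _] := ceil_ratioP U0; rewrite -pmulrn.
pose P r := exists2 U, U <> 0%VS & is_covering_ratio rho U r.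
pose cr d := `|Num.ceil ((\dim {:V})%:R / d%:R : rat)|%N.
pose s := [seq (m%:R / (cr d)%:R : rat) | d <- iota 0 (\dim {:V}).+1,
                                          m <- iota 0 (B * cr d).+1].
have Ps r : P r -> r \in s.
  move=> [U U0 /(ratioP U r U0)[m mB ->]].
  apply/allpairsPdep; exists (\dim U), m; split=> //.
    by rewrite mem_iota /= add0n ltnS dimvS ?subvf.
  by rewrite mem_iota /= add0n ltnS.
have [|r [U U0 Ur] max_r] := ex_max_of_finite _ Ps.
  by have [r Ur] := ratio_ex _ irr.1; exists r, fullv => //; exact: irr.1.
exists r.
  split=> //; first by exists U.
  move=> U' U0'; have [r' Ur'] := ratio_ex _ U0'; exists r' => //.
  by apply: max_r; exists U'.
have [m mB ->] := ratioP _ _ U0 Ur; have [_ c0 _] := ceil_ratioP U0.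
by rewrite ler_pdivrMr ?ltr0n // -natrM ler_nat.
Qed.
End Complexity.

(** Here 2 X conjugates cover the corner: X q d >= q N >= a b d, so that
    2 X q >= 2 a b. *)
Lemma sl_translates_cover (F : numClosedFieldType) n (U : {vspace sl F n}) :
  (2 <= n)%N -> U <> 0%VS ->
  translates_cover (conj_rep F n) U (12 * ceil_ratio U).
Proof.
move=> n2 U0; pose a := n./2; pose b := (n - a)%N.
have E : n = (a + b)%N by rewrite /b /a; lia.
have [a0 ab ba] : [/\ 0 < a, a <= b & b <= a.+1]%N by rewrite /b /a; split; lia.
move: (a) (b) E a0 ab ba => {a b}a b E; subst n => a0 ab ba.
have d0 : (0 < \dim U)%N by rewrite lt0n dimv_eq0; apply/eqP.
have [g ug hg] := large_corner U n2.
rewrite -[12%N]/(6 * 2)%N -mulnA; apply: (corner_cover a0 ab ba ug).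
rewrite -mulnA leq_mul2l /= -(leq_pmul2r d0) (leq_trans hg) //.
have [_ _] := ceil_ratioP U0; rewrite dim_sl ?addn_gt0 ?a0 // => hN.
by rewrite mulnAC mulnC leq_mul2r hN orbT.
Qed.

Unset Implicit Arguments.

Theorem proposition7p3 (R : realType) (n : nat) (hn : (2 <= n)%N) :
  exists2 c : rat, is_covering_complexity (conj_rep R[i] n) c & c < 18%:R.
Proof.
have [c hc c12] := covering_complexity_le (sl_irreducible R[i] hn)
  (fun U => sl_translates_cover (U := U) hn).
by exists c => //; apply: le_lt_trans c12 _; rewrite ltr_nat.
Qed.
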